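(* Let $0<\alpha\le 1$ and $c>0$ be real numbers and let $k(n)=cn^{\alpha}$ for all $n\in\mathbb{N}^+$. Then there exists a set $S\subseteq\mathbb{N}^+\times\mathbb{N}^+$ such that $$\liminf_{n\to\infty}\frac{|S\cap[1,n]^2|}{k(n)\cdot n}>0$$ and, for every $n\in\mathbb{N}^+$, each line in the plane contains at most $k(n)$ points of $S\cap[1,n]^2$.
   Context: $\mathbb{N}^+$ denotes the positive integers. $[1,n]^2$ denotes the set of lattice points $(x,y)\in\mathbb{Z}^2$ with $1\le x\le n$ and $1\le y\le n$. ''Line'' means any straight line in $\mathbb{R}^2$ (of arbitrary slope, including vertical lines). *)

(* Defs.v *)
From HB Require Import structures.
From mathcomp Require Import all_boot all_order all_algebra finmap.
From mathcomp Require Import all_classical all_reals all_analysis.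

Set Implicit Arguments.
Unset Strict Implicit.
Unset Printing Implicit Defensive.

Import Order.TTheory GRing.Theory Num.Theory.

Local Open Scope classical_set_scope.
Local Open Scope ring_scope.

(* Sets of lattice points with positive coordinates are sets of type
   [set (nat * nat)]; positivity is an explicit condition. *)
Definition posQuadrant : set (nat * nat) :=
  [set p | (0 < p.1)%N /\ (0 < p.2)%N].

Definition grid (n : nat) : set (nat * nat) :=
  [set p | (1 <= p.1 <= n)%N /\ (1 <= p.2 <= n)%N].

Definition toPlane (R : realType) (p : nat * nat) : R * R :=
  (p.1%:R, p.2%:R).

Definition is_line (R : realType) (L : set (R * R)) : Prop :=
  exists a b d : R, (a, b) != (0, 0) /\
    L = [set q : R * R | a * q.1 + b * q.2 = d].

(* [fset_set A] is empty when [A] is infinite, so [npoints] is a genuine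
   cardinality on finite sets only; [finite_gridI] covers every use of it. *)
Definition npoints (A : set (nat * nat)) : nat := #|` fset_set A|.

Lemma finite_grid (n : nat) : finite_set (grid n).
Proof.
apply: (@sub_finite_set _ _ (`I_n.+1 `*` `I_n.+1)).
  by move=> [x y] /= [/andP[_ hx] /andP[_ hy]]; split; rewrite /= ltnS.
by apply: finite_setX; exact: finite_II.
Qed.

Lemma finite_gridI (A : set (nat * nat)) (n : nat) :
  finite_set (A `&` grid n).
Proof. by apply: sub_finite_set (finite_grid n) => p []. Qed.

(* Main.v *)
Require Import Defs.
From HB Require Import structures.
From mathcomp Require Import all_boot all_order all_algebra finmap.
From mathcomp Require Import all_classical all_reals all_analysis.
From mathcomp Require Import zify ring lra.

Set Implicit Arguments.
Unset Strict Implicit.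
Unset Printing Implicit Defensive.

Import Order.TTheory GRing.Theory Num.Theory.

(** Write a = 2^alpha, so that 1 < a <= 2 and n^alpha is within a factor a of
    a^j when 2^j <= n < 2^(j+1).  The set S is a disjoint union of blocks, the
    j-th one contained in the dyadic square [2^j, 2^(j+1))^2.  If the j-th block
    meets every line in at most 10 delta a^j points, then a line meets
    S inside [1, n]^2 in at most 10 delta (1 + a + ... + a^j) points, and as
    a > 1 this geometric sum is dominated by its last term: it is at most c a^j
    for delta small enough.  If moreover the blocks of large index have at least
    (delta / 4) 2^j a^j points, the block just below n alone gives S the density
    required.

    Such a block is obtained from the classical construction of Erdos for the
    no-three-in-line problem.  Let p be a prime; the parabolas
    y = x^2 + t mod p, for t < m, cover the fraction m / p of the lattice
    points.  In a box of side p, a line has at most two points on each of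
    them (no_three_on_parabola).  A line crosses O(2^j / p) boxes of the square,
    because along a line the coordinates of the boxes are both monotone, so the
    sum or the difference of these coordinates tells the boxes apart; a line
    therefore has O(m 2^j / p) points in the block (size_line_parabolas).  The
    average over horizontal lines has the same order of magnitude, which is why
    nothing is lost.  Taking m / p close to delta (a / 2)^j gives both bounds
    (dyadic_block).

    As boxes may be smaller than the square, p need only satisfy
    (2 / a)^j / delta <= p <= 2^j, the lower bound being what makes m positive.
    This window has an exponentially growing ratio, so a very weak form of
    Chebyshev's theorem is enough (prime_between): every prime power dividing a
    binomial coefficient C(n, i) is at most n, hence if all primes up to n were
    smaller than y then 2^n, the sum of the C(n, i), would be at most
    (n + 1) n^y. *)

(** * Primes in a wide interval *)

Section Prime.
Local Open Scope nat_scope.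

(** In Legendre's formula the digit k contributes at most one carry, and none
    when p ^ k exceeds n; so the valuation is at most the logarithm of n. *)
Lemma pfactor_binomial_leq n m p : 0 < n -> m <= n -> prime p ->
  p ^ logn p 'C(n, m) <= n.
Proof.
move=> n_gt0 le_mn p_pr; have p_gt1 := prime_gt1 p_pr.
apply: leq_trans (trunc_logP p_gt1 n_gt0); rewrite leq_exp2l //.
have legendre q : q <= n -> logn p q`! = \sum_(1 <= k < n.+1) q %/ p ^ k.
  move=> le_qn; rewrite logn_fact // [RHS](big_cat_nat _ (n := q.+1)) //=.
  rewrite [X in _ = _ + X]big_nat_cond [X in _ = _ + X]big1 ?addn0 //.
  move=> k /andP[/andP[lt_qk _] _]; rewrite divn_small //.
  exact: ltn_trans lt_qk (ltn_expl _ p_gt1).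
have := congr1 (logn p) (bin_fact le_mn).
rewrite lognM ?muln_gt0 ?fact_gt0 ?bin_gt0 // lognM ?fact_gt0 //.
rewrite !legendre ?leq_subr // -big_split /= => E.
rewrite -(leq_add2r (\sum_(1 <= k < n.+1) (m %/ p ^ k + (n - m) %/ p ^ k))) E.
have -> : trunc_log p n = \sum_(1 <= k < n.+1) (p ^ k <= n).
  have le_tn : (trunc_log p n) <= n.
    by apply: leq_trans (ltnW (ltn_expl _ p_gt1)) (trunc_logP p_gt1 n_gt0).
  rewrite (big_cat_nat _ (n := (trunc_log p n).+1)) //=.
  rewrite [X in _ + X]big_nat_cond [X in _ + X]big1 ?addn0; last first.
    move=> k /andP[/andP[lt_tk _] _]; case: leqP => // /(trunc_log_max p_gt1).
    by rewrite leqNgt lt_tk.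
  rewrite (eq_big_nat _ _ (F2 := fun=> 1)) ?sum_nat_const_nat ?muln1 ?subn1 //.
  move=> k /andP[_ lt_kt]; rewrite (leq_trans _ (trunc_logP p_gt1 n_gt0)) //.
  by rewrite leq_exp2l.
rewrite -big_split /=; apply: leq_sum => k _.
have pk_gt0 : 0 < p ^ k by rewrite expn_gt0 prime_gt0.
rewrite -{1}(subnKC le_mn) divnD // addnC leq_add2r.
case: (leqP (p ^ k) n) => [_|lt_n]; first exact: leq_b1.
by rewrite !modn_small ?(leq_ltn_trans _ lt_n) ?leq_subr // subnKC //
  [p ^ k <= n]leqNgt lt_n.
Qed.

Lemma binomial_leq_primes n m s : 0 < n -> m <= n ->
  (forall p, prime p -> p <= n -> p < s) -> 'C(n, m) <= n ^ s.
Proof.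
move=> n_gt0 le_mn hs; have C_gt0 : 0 < 'C(n, m) by rewrite bin_gt0.
rewrite {1}(prod_prime_decomp C_gt0) prime_decompE big_map /=.
apply: (@leq_trans (n ^ size (primes 'C(n, m)))).
  have <- : \prod_(p <- primes 'C(n, m)) n = n ^ size (primes 'C(n, m)).
    by rewrite big_const_seq iter_muln_1 count_predT.
  rewrite big_seq [leqRHS]big_seq.
  apply: leq_prod => p; rewrite mem_primes => /andP[p_pr _].
  exact: pfactor_binomial_leq.
rewrite leq_pexp2l // -(size_iota 0 s) uniq_leq_size ?primes_uniq // => p.
rewrite mem_primes mem_iota => /and3P[p_pr _ p_dvd]; rewrite add0n hs //.
have := dvdn_mulr (m`! * (n - m)`!) p_dvd; rewrite bin_fact //.
elim: (n) => [|k IH]; first by rewrite dvdn1 => /eqP p1; rewrite p1 in p_pr.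
by rewrite factS Euclid_dvdM // => /orP[p_dvdk|/IH le_pk];
  [exact: dvdn_leq|exact: leqW].
Qed.

(** Otherwise each C(2 ^ j, i) would be at most (2 ^ j) ^ y, and summing over i
    would bound 2 ^ (2 ^ j) by 2 ^ (j * y.+1 + 1). *)
Lemma prime_between j y : j * y.+1 + 1 < 2 ^ j ->
  exists p, [/\ prime p, y <= p & p <= 2 ^ j].
Proof.
move=> hj; have n_gt0 : 0 < 2 ^ j by rewrite expn_gt0.
have [/hasP[p]|/hasPn no_p] :=
    boolP (has (fun p => prime p && (y <= p)) (iota 0 (2 ^ j).+1)).
  by rewrite mem_iota ltnS => le_p /andP[p_pr le_yp]; exists p.
suff : 2 ^ (2 ^ j) <= 2 ^ (j * y.+1 + 1) by rewrite leq_exp2l // leqNgt hj.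
rewrite -[X in X ^ (2 ^ j)]/(1 + 1) expnDn.
apply: (@leq_trans (\sum_(i < (2 ^ j).+1) (2 ^ j) ^ y)).
  apply: leq_sum => i _; rewrite !exp1n !muln1.
  apply: binomial_leq_primes => // [|p p_pr le_p]; first by rewrite -ltnS.
  by have := no_p p; rewrite mem_iota ltnS p_pr -ltnNge; apply.
rewrite sum_nat_const card_ord -expnM addn1 expnS mulnS expnD mulnA.
by rewrite leq_mul2r; apply/orP; right; lia.
Qed.
End Prime.

(** * Lines and parabolas modulo a prime *)

Section Points.
Local Open Scope nat_scope.

Lemma sum_count_key (T : eqType) (key : T -> nat) K (s : seq T) :
  {in s, forall x, key x < K} ->
  size s = \sum_(k < K) count (fun x => key x == k) s.
Proof.
elim: s => [|x s IH] hK /=; first by rewrite big1.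
rewrite big_split /= -IH => [|y ys]; last by apply: hK; rewrite inE ys orbT.
rewrite (bigD1 (Ordinal (hK x (mem_head _ _)))) //= eqxx big1 ?addn0 //.
move=> k; apply: contraNeq; rewrite eqb0 negbK => /eqP E.
by apply/eqP/val_inj.
Qed.

Lemma count_le2 (T : eqType) (P : pred T) (s : seq T) : uniq s ->
  (forall x y z, x \in s -> y \in s -> z \in s -> P x -> P y -> P z ->
     uniq [:: x; y; z] -> False) -> count P s <= 2.
Proof.
move=> us h; rewrite -size_filter; have := filter_uniq P us.
have : {subset [seq x <- s | P x] <= [pred x | (x \in s) && P x]}.
  by move=> x; rewrite mem_filter inE andbC.
case: [seq x <- s | P x] => [|x [|y [|z t]]] // hsub u; exfalso.
have /andP[xs Px] := hsub x ltac:(by rewrite !inE eqxx).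
have /andP[ys Py] := hsub y ltac:(by rewrite !inE eqxx orbT).
have /andP[zs Pz] := hsub z ltac:(by rewrite !inE eqxx !orbT).
apply: (h x y z) => //; move: u => /=; rewrite !inE !negb_or.
by case/and4P => /and3P[-> -> _] /andP[-> _].
Qed.

(** This is y - x ^ 2 modulo p for z = (x, y): as p.-1 is -1 modulo p, the
    truncated subtraction of nat is avoided. *)
Definition parabola_index p (z : nat * nat) := (z.2 + p.-1 * z.1 ^ 2) %% p.

Local Open Scope ring_scope.

Definition collinear (u v w : nat * nat) :=
  (v.1%:Z - u.1%:Z) * (w.2%:Z - u.2%:Z) = (w.1%:Z - u.1%:Z) * (v.2%:Z - u.2%:Z).

(** Two points on the same translate of the parabola span a line of slope
    v.1 + u.1 modulo p. *)
Lemma parabola_index_dvd p u v : prime p ->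
  parabola_index p u = parabola_index p v ->
  (p %| (v.2%:Z - u.2%:Z) - (v.1%:Z - u.1%:Z) * (v.1%:Z + u.1%:Z))%Z.
Proof.
move=> p_pr /esym/eqP; have p_gt0 := prime_gt0 p_pr.
rewrite -(eqz_nat) -!modz_nat eqz_mod_dvd => h.
have -> : (v.2%:Z - u.2%:Z) - (v.1%:Z - u.1%:Z) * (v.1%:Z + u.1%:Z) =
   (v.2 + p.-1 * v.1 ^ 2)%N%:Z - (u.2 + p.-1 * u.1 ^ 2)%N%:Z
   - p%:Z * (v.1%:Z ^+ 2 - u.1%:Z ^+ 2).
  have -> : p%:Z = p.-1%:Z + 1 by lia.
  by rewrite !PoszD !PoszM -!rmorphXn /=; ring.
by rewrite rpredB // dvdz_mulr.
Qed.

Lemma eq_of_dvd_box p (x y : nat) : prime p ->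
  (x %/ p = y %/ p)%N -> (p %| x%:Z - y%:Z)%Z -> x = y.
Proof.
move=> p_pr h; rewrite -eqz_mod_dvd !modz_nat => /eqP [E].
by rewrite (divn_eq x p) (divn_eq y p) h E.
Qed.

Lemma eq_of_parabola p (u v : nat * nat) : prime p ->
  parabola_index p u = parabola_index p v ->
  (u.1 %/ p = v.1 %/ p)%N -> (u.2 %/ p = v.2 %/ p)%N ->
  (p %| v.1%:Z - u.1%:Z)%Z -> u = v.
Proof.
move=> p_pr /(parabola_index_dvd p_pr) h b1 b2 d.
have E1 : v.1 = u.1 by apply: (eq_of_dvd_box p_pr).
have E2 : v.2 = u.2.
  by apply: (eq_of_dvd_box p_pr) => //; move: h; rewrite E1 subrr mul0r subr0.
by case: u v E1 E2 {h b1 b2 d} => [? ?] [? ?] /= -> ->.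
Qed.

(** For points on a common parabola the determinant expressing collinearity is,
    modulo p, the Vandermonde determinant of the abscissas.  Its vanishing makes
    two abscissas congruent, hence two of the points congruent, and congruent
    points of the same box are equal. *)
Lemma no_three_on_parabola p (u v w : nat * nat) : prime p ->
  parabola_index p u = parabola_index p v ->
  parabola_index p u = parabola_index p w ->
  (u.1 %/ p = v.1 %/ p)%N -> (u.2 %/ p = v.2 %/ p)%N ->
  (u.1 %/ p = w.1 %/ p)%N -> (u.2 %/ p = w.2 %/ p)%N ->
  collinear u v w -> uniq [:: u; v; w] -> False.
Proof.
move=> p_pr huv huw xv yv xw yw col.
have : (p %| (v.1%:Z - u.1%:Z) * (w.1%:Z - u.1%:Z) * (w.1%:Z - v.1%:Z))%Z.
  have -> : (v.1%:Z - u.1%:Z) * (w.1%:Z - u.1%:Z) * (w.1%:Z - v.1%:Z) =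
    (w.1%:Z - u.1%:Z) * ((v.2%:Z - u.2%:Z) - (v.1%:Z - u.1%:Z) * (v.1%:Z + u.1%:Z))
  - (v.1%:Z - u.1%:Z) * ((w.2%:Z - u.2%:Z) - (w.1%:Z - u.1%:Z) * (w.1%:Z + u.1%:Z)).
    by move/eqP: col; rewrite -subr_eq0 => /eqP col; rewrite -[LHS]subr0 -col; ring.
  by rewrite rpredB // dvdz_mull // parabola_index_dvd.
have euclid (a b : int) : (p %| a * b)%Z -> (p %| a)%Z \/ (p %| b)%Z.
  by rewrite !dvdzE abszM Euclid_dvdM //= => /orP.
rewrite /= !inE negb_or andbT => + /andP[/andP[/eqP nuv /eqP nuw] /eqP nvw].
case/euclid => [/euclid[] d|d].
- by apply: nuv; apply: (eq_of_parabola p_pr).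
- by apply: nuw; apply: (eq_of_parabola p_pr).
- by apply: nvw; apply: (eq_of_parabola p_pr) => //; congruence.
Qed.

(** The points are pairwise ordered, either all in the direction of the first
    quadrant or all in that of the second, as on a line according to the sign of
    its slope. *)
Definition monotone_points (s : seq (nat * nat)) :=
  {in s &, forall u v, 0 <= (v.1%:Z - u.1%:Z) * (v.2%:Z - u.2%:Z)} \/
  {in s &, forall u v, (v.1%:Z - u.1%:Z) * (v.2%:Z - u.2%:Z) <= 0}.

Lemma same_direction (a b x y : nat) : 0 <= (x%:Z - a%:Z) * (y%:Z - b%:Z) ->
  (a <= x /\ b <= y \/ x <= a /\ y <= b)%N.
Proof.
case: (ltngtP a x) => [lt_ax|lt_xa|->]; last by case: (leqP b y); lia.
  by rewrite pmulr_rge0 ?subr_gt0 // subr_ge0; lia.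
by rewrite nmulr_rge0 ?subr_lt0 // subr_le0; lia.
Qed.

Local Open Scope nat_scope.

(** Along monotone points a single integer determines the box: the sum of the
    coordinates of the box when they both grow, their difference (shifted by B
    to remain a natural number) when one grows and the other decreases.
    Together with the index of the parabola this integer is a key that at most
    two points of a line share. *)
Lemma size_line_parabolas p m B (s : seq (nat * nat)) : prime p -> uniq s ->
  {in s & &, forall u v w, collinear u v w} -> monotone_points s ->
  {in s, forall u, parabola_index p u < m} ->
  {in s, forall u, u.1 %/ p <= B /\ u.2 %/ p <= B} ->
  size s <= (2 * B + 1) * m * 2.
Proof.
move=> p_pr us col mono hm hB.
have [box [box_lt box_inj]] : exists box : nat * nat -> nat,
    {in s, forall u, box u < 2 * B + 1} /\ {in s &, forall u v,
      box u = box v -> u.1 %/ p = v.1 %/ p /\ u.2 %/ p = v.2 %/ p}.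
  case: mono => mono.
    exists (fun u => u.1 %/ p + u.2 %/ p); split=> [u /hB|u v us' vs' E]; first lia.
    have [[/(leq_div2r p) ? /(leq_div2r p) ?]|[/(leq_div2r p) ? /(leq_div2r p) ?]] :
      u.1 <= v.1 /\ u.2 <= v.2 \/ v.1 <= u.1 /\ v.2 <= u.2; [|lia|lia].
    exact/same_direction/mono.
  exists (fun u => u.1 %/ p + (B - u.2 %/ p)); split=> [u /hB[]|u v us' vs' E].
    by move: (u.1 %/ p) (u.2 %/ p) => i i'; lia.
  have [[/(leq_div2r p) ? /(leq_div2r p) ?]|[/(leq_div2r p) ? /(leq_div2r p) ?]] :
    u.1 <= v.1 /\ v.2 <= u.2 \/ v.1 <= u.1 /\ u.2 <= v.2.
  - have h : (0 <= (v.1%:Z - u.1%:Z) * (u.2%:Z - v.2%:Z))%R.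
      by rewrite -[(u.2%:Z - _)%R]opprB mulrN oppr_ge0; exact: mono.
    exact: same_direction h.
  - by have := hB u us'; have := hB v vs'; lia.
  - by have := hB u us'; have := hB v vs'; lia.
pose key u := box u * m + parabola_index p u.
have key_lt : {in s, forall u, key u < (2 * B + 1) * m}.
  move=> u hu; have := hm u hu; have := box_lt u hu; rewrite /key; nia.
rewrite (sum_count_key key_lt).
apply: (@leq_trans (\sum_(k < (2 * B + 1) * m) 2)); last first.
  by rewrite sum_nat_const card_ord.
apply: leq_sum => k _; apply: count_le2 => // u v w hu hv hw /eqP ku /eqP kv /eqP kw.
have key_inj x y : x \in s -> y \in s -> key x = key y ->
    [/\ parabola_index p x = parabola_index p y,
        x.1 %/ p = y.1 %/ p & x.2 %/ p = y.2 %/ p].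
  move=> hx hy E; have m_gt0 : 0 < m by apply: leq_ltn_trans (hm x hx).
  have Ep : parabola_index p x = parabola_index p y.
    have := congr1 (modn^~ m) E.
    by rewrite /key !modnMDl !modn_small // hm.
  have Eb : box x = box y.
    by move: E; rewrite /key Ep => /addIn/eqP; rewrite eqn_pmul2r // => /eqP.
  by have [] := box_inj x y hx hy Eb.
have [? ? ?] := key_inj u v hu hv (etrans ku (esym kv)).
have [? ? ?] := key_inj u w hu hw (etrans ku (esym kw)).
by apply: (@no_three_on_parabola p u v w) => //; apply: col.
Qed.
End Points.

(** * Counting the points of a block *)

Section Count.
Local Open Scope nat_scope.

Lemma count_residues p m M : 0 < p -> m <= p ->
  count (fun y => y %% p < m) (iota M p) = m.
Proof.
move=> p_gt0 le_mp; elim: M => [|M IH].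
  have /eq_in_count -> : {in iota 0 p, (fun y => y %% p < m) =1 (fun y => y < m)}.
    by move=> y; rewrite mem_iota => /andP[_ ?]; rewrite modn_small.
  rewrite -(subnKC le_mp) iotaD count_cat add0n.
  have /eq_in_count -> : {in iota 0 m, (fun y => y < m) =1 predT}.
    by move=> y; rewrite mem_iota => /andP[_ ->].
  have /eq_in_count -> : {in iota m (p - m), (fun y => y < m) =1 pred0}.
    by move=> y; rewrite mem_iota => /andP[? _]; rewrite ltnNge /=; apply/negbF.
  by rewrite count_predT count_pred0 size_iota addn0.
rewrite -{}[RHS]IH; case: p p_gt0 {le_mp} => // p _.
have -> : iota M.+1 p.+1 = iota M.+1 p ++ [:: M.+1 + p].
  by rewrite -(addn1 p) iotaD.
by rewrite count_cat /= addSnnS modnDr addn0 addnC.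
Qed.

Lemma count_shifted_residues p m c M K : 0 < p -> m <= p ->
  K %/ p * m <= count (fun y => (y + c) %% p < m) (iota M K).
Proof.
move=> p_gt0 le_mp; rewrite {2}(divn_eq K p).
elim: (K %/ p) M => [|q IH] M //.
rewrite mulSn mulSn -addnA iotaD count_cat leq_add //.
rewrite -{1}(count_residues (M + c) p_gt0 le_mp) [M + c]addnC iotaDl count_map.
by rewrite leq_eqVlt; apply/orP/or_introl/eqP/eq_count => y /=; rewrite addnC.
Qed.

(** Each column meets every parabola once in each period p, so that it has m
    points of the m parabolas in each period. *)
Lemma parabolas_many_points p m M K : 0 < p -> m <= p ->
  exists s : seq (nat * nat), [/\ uniq s, K * (K %/ p * m) <= size s &
    {in s, forall z, [/\ M <= z.1 < M + K, M <= z.2 < M + K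
                       & parabola_index p z < m]}].
Proof.
move=> p_gt0 le_mp.
pose col x := [seq y <- iota M K | parabola_index p (x, y) < m].
exists [seq (x, y) | x <- iota M K, y <- col x]; split.
- apply: allpairs_uniq_dep; first exact: iota_uniq.
    by move=> x _; rewrite filter_uniq ?iota_uniq.
  by move=> [x y] [x' y'] _ _ /= [-> ->].
- rewrite size_allpairs_dep -{1}(size_iota M K).
  elim: (iota M K) => // x s IH /=; rewrite mulSn leq_add //.
  by rewrite size_filter; exact: (count_shifted_residues (p.-1 * x ^ 2) M K).
- move=> z /allpairsPdep[x [y [xs ys ->]]] /=.
  by move: xs ys; rewrite mem_filter !mem_iota => -> /andP[-> ->].
Qed.

(** Here t is the number of boxes along a side of a square of side 2 X.  Since
    p <= X, the factor 2 t + 1 is at most 5 X / p: this is the origin of the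
    constant 10 in the bound for the lines. *)
Lemma rescale_line_bound X t p m s : p <= X -> t * p <= 2 * X ->
  s <= (2 * t + 1) * m * 2 -> s * p <= 10 * X * m.
Proof.
move=> le_pX le_tp le_s.
have h : (2 * t + 1) * p <= 5 * X by rewrite mulnDl; lia.
apply: (@leq_trans ((2 * t + 1) * m * 2 * p)); first by rewrite leq_mul2r le_s orbT.
have -> : (2 * t + 1) * m * 2 * p = (2 * t + 1) * p * (m * 2) by ring.
have -> : 10 * X * m = 5 * X * (m * 2) by ring.
by rewrite leq_mul2r h orbT.
Qed.

Lemma leq_double_trunc p X : 0 < p -> p <= X -> X <= X %/ p * (2 * p).
Proof.
move=> p_gt0 le_pX; have := ltn_ceil X p_gt0; rewrite mulSn mulnCA.
have : p <= X %/ p * p by rewrite leq_pmull // divn_gt0.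
by move: (X %/ p * p) => t; lia.
Qed.
End Count.

(** * Dyadic blocks *)

Section Block.
Local Open Scope ring_scope.

Definition dyadic_square j (z : nat * nat) :=
  ((2 ^ j <= z.1 < 2 ^ j.+1) && (2 ^ j <= z.2 < 2 ^ j.+1))%N.

(** The number m of parabolas is the integral part of delta p (a / 2) ^ j, which
    the assumption on p makes at least 1: rounding down thus loses at most a
    factor 2.  As boxes of side p need not tile the square, counting full
    periods loses another factor 2, whence delta / 4. *)
Lemma dyadic_block (R : realType) (a delta : R) j p : 0 < a <= 2 -> 0 < delta <= 1 ->
  prime p -> (p <= 2 ^ j)%N -> 2 ^+ j <= delta * p%:R * a ^+ j ->
  exists A : pred (nat * nat), [/\ {subset A <= dyadic_square j},
    (forall s, uniq s -> {subset s <= A} ->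
       {in s & &, forall u v w, collinear u v w} -> monotone_points s ->
       (size s)%:R <= 10 * delta * a ^+ j) &
    exists s, [/\ uniq s, {subset s <= A} &
      delta / 4 * 2 ^+ j * a ^+ j <= (size s)%:R]].
Proof.
move=> /andP[a_gt0 a_le2] /andP[d_gt0 d_le1] p_pr le_p hp.
have p_gt0 := prime_gt0 p_pr; have pR : 0 < p%:R :> R by rewrite ltr0n.
have X_gt0 : 0 < 2 ^+ j :> R by rewrite exprn_gt0 ?ltr0n.
have aj_gt0 : 0 < a ^+ j by rewrite exprn_gt0.
have aj_le : a ^+ j <= 2 ^+ j by apply: lerXn2r; rewrite ?nnegrE; lra.
set X : R := 2 ^+ j in X_gt0 hp aj_le *.
have XE : X = (2 ^ j)%:R by rewrite natrX.
pose q := delta * p%:R * a ^+ j / X.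
have q_ge1 : 1 <= q by rewrite ler_pdivlMr ?mul1r.
have qX : q * X = delta * p%:R * a ^+ j by rewrite /q mulfVK ?gt_eqF.
pose m := Num.truncn q.
have /andP[m_le m_gt] : m%:R <= q < m.+1%:R by apply: truncn_itv; lra.
have m_ge1 : 1 <= m%:R :> R by rewrite ler1n /m truncn_gt0.
have le_mp : (m <= p)%N.
  rewrite -(ler_nat R) (le_trans m_le) // ler_pdivrMr //.
  rewrite -mulrA mulrCA ler_pM2l //.
  by rewrite (le_trans _ aj_le) // ler_piMl // ltW.
exists [pred z | dyadic_square j z && (parabola_index p z < m)%N]; split.
- by move=> z /andP[].
- move=> s us sA col mono.
  have hsz : (size s <= (2 * (2 ^ j.+1 %/ p) + 1) * m * 2)%N.
    apply: (size_line_parabolas p_pr us col mono) => u /sA; first by case/andP.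
    case/andP => /andP[/andP[_ h1] /andP[_ h2]] _.
    by rewrite !leq_div2r // ltnW.
  have {hsz} : (size s * p <= 10 * 2 ^ j * m)%N.
    by apply: (rescale_line_bound le_p _ hsz); rewrite -expnS leq_trunc_div.
  rewrite -(ler_nat R) !natrM -XE => hsz.
  rewrite -(ler_pM2r pR) (le_trans hsz) //.
  have : m%:R * X <= q * X by rewrite ler_pM2r.
  rewrite qX; lra.
- have [s [us hs sP]] := @parabolas_many_points p m (2 ^ j) (2 ^ j) p_gt0 le_mp.
  exists s; split=> // [z /sP[h1 h2 h3]|].
    by rewrite inE h3 andbT /dyadic_square expnS mul2n -addnn h1 h2.
  have {hs} : (2 ^ j * 2 ^ j * m <= size s * (2 * p))%N.
    have := leq_double_trunc p_gt0 le_p.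
    move=> h; apply: leq_trans (leq_mul hs (leqnn _)).
    by rewrite -!mulnA leq_mul2l [(m * _)%N]mulnC mulnA leq_mul2r h !orbT.
  rewrite -(ler_nat R) !natrM -XE => hsz.
  rewrite -(ler_pM2r pR).
  have : delta * p%:R * a ^+ j <= 2 * m%:R * X.
    rewrite -qX ler_pM2r //; move: m_gt; rewrite -natr1; lra.
  have -> : delta / 4 * X * a ^+ j * p%:R = X * (delta * p%:R * a ^+ j) / 4 by ring.
  move=> h; rewrite ler_pdivrMr //.
  apply: (@le_trans _ _ (X * (2 * m%:R * X))); first by rewrite ler_pM2l.
  by lra.
Qed.

(** The exponential dominates the quadratic term of its series. *)
Lemma exp_gt_linear (R : realType) (a D : R) : 1 < a ->
  exists j0, forall j, (j0 <= j)%N -> D * j%:R + 1 < a ^+ j.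
Proof.
move=> a_gt1; have la : 0 < ln a by rewrite ln_gt0.
have a_gt0 : 0 < a by lra.
pose j0 := (Num.truncn (2 * `|D| / ln a ^+ 2)).+1.
exists j0 => j le_j.
have j_gt0 : 0 < j%:R :> R by rewrite ltr0n (leq_trans _ le_j).
have -> : a ^+ j = expR (j%:R * ln a) by rewrite expRM_natl lnK.
apply: lt_le_trans (expR_ge1Dxn 1 _); last by rewrite mulr_ge0 // ltW.
rewrite [ltRHS]addrC ltrD2r; apply: le_lt_trans (_ : `|D| * j%:R < _).
  by apply: ler_wpM2r; [exact: ltW|exact: ler_norm].
have : 2 * `|D| / ln a ^+ 2 < j%:R.
  by apply: lt_le_trans (truncnS_gt _) _; rewrite ler_nat.
rewrite ltr_pdivrMr ?exprn_gt0 // => h.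
have -> : (2)`!%:R = 2 :> R by [].
rewrite ltr_pdivlMr //.
have -> : (j%:R * ln a) ^+ 2 = (j%:R * ln a ^+ 2) * j%:R by ring.
by rewrite mulrAC ltr_pM2r // mulrC.
Qed.

(** The interval from (2 / a) ^ j / delta to 2 ^ j is wide enough for
    prime_between as soon as a ^ j exceeds a suitable affine function of j. *)
Lemma prime_for_block (R : realType) (a delta : R) j : 0 < a <= 2 -> 0 < delta ->
  (delta^-1 + 2) * j%:R + 1 < a ^+ j ->
  exists p, [/\ prime p, (p <= 2 ^ j)%N & 2 ^+ j <= delta * p%:R * a ^+ j].
Proof.
move=> /andP[a_gt0 a_le2] d_gt0 h.
have X_gt0 : 0 < 2 ^+ j :> R by rewrite exprn_gt0 ?ltr0n.
have aj_gt0 : 0 < a ^+ j by rewrite exprn_gt0.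
have aj_le : a ^+ j <= 2 ^+ j by apply: lerXn2r; rewrite ?nnegrE; lra.
pose q := 2 ^+ j / (delta * a ^+ j).
have q_ge0 : 0 <= q by rewrite divr_ge0 ?mulr_ge0 ?ltW.
pose y := (Num.truncn q).+1.
have y_gt : q < y%:R by exact: truncnS_gt.
have y_le : y%:R <= q + 1.
  by rewrite /y -natr1 lerD2r; have /andP[] := truncn_itv q_ge0.
have [|p [p_pr le_yp le_p]] := @prime_between j y.
  rewrite -(ltr_nat R) natrD natrM natrX -natr1.
  have j_ge0 : 0 <= j%:R :> R by [].
  apply: (@le_lt_trans _ _ (j%:R * (q + 2) + 1)).
    by rewrite lerD2r ler_wpM2l //; lra.
  rewrite -(ltr_pM2r aj_gt0).
  have -> : (j%:R * (q + 2) + 1) * a ^+ j =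
      2 ^+ j * (delta^-1 * j%:R) + (2 * j%:R + 1) * a ^+ j.
    by rewrite /q; field; rewrite !gt_eqF.
  apply: (@le_lt_trans _ _ (2 ^+ j * ((delta^-1 + 2) * j%:R + 1))).
    have -> : 2 ^+ j * ((delta^-1 + 2) * j%:R + 1) =
      2 ^+ j * (delta^-1 * j%:R) + (2 * j%:R + 1) * 2 ^+ j :> R by ring.
    by rewrite lerD2l ler_wpM2l //; lra.
  by rewrite ltr_pM2l.
exists p; split=> //; move: y_gt => /(lt_le_trans)/(_ _).
have : y%:R <= p%:R :> R by rewrite ler_nat.
move=> le_ypR /(_ _ le_ypR); rewrite /q ltr_pdivrMr ?mulr_gt0 // => /ltW.
by rewrite mulrA [p%:R * _]mulrC.
Qed.
End Block.

(** * Lattice points on a real line *)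

Section Lines.
Local Open Scope ring_scope.

Lemma line_collinear (R : realType) (L : set (R * R)) (lineL : is_line L)
    (u v w : nat * nat) : L (toPlane R u) -> L (toPlane R v) ->
  L (toPlane R w) -> collinear u v w.
Proof.
have [a [b [d [ab_neq0 ->]]]] := lineL; rewrite /= => hu hv hw.
apply: (@intr_inj R); rewrite !rmorphM !rmorphB /= -!pmulrn.
set x1 := _ - _; set y2 := _ - _.
set x2 := (X in _ = X * _); set y1 := (X in _ = _ * X).
have h1 : a * x1 + b * y1 = 0 by rewrite /x1 /y1; lra.
have h2 : a * x2 + b * y2 = 0 by rewrite /x2 /y2; lra.
apply/eqP; rewrite -subr_eq0; apply/eqP.
have ha : a * (x1 * y2 - x2 * y1) = 0.
  have -> : a * (x1 * y2 - x2 * y1) =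
    (a * x1 + b * y1) * y2 - (a * x2 + b * y2) * y1 by ring.
  by rewrite h1 h2 !mul0r subr0.
have hb : b * (x1 * y2 - x2 * y1) = 0.
  have -> : b * (x1 * y2 - x2 * y1) =
    (a * x2 + b * y2) * x1 - (a * x1 + b * y1) * x2 by ring.
  by rewrite h1 h2 !mul0r subr0.
move/eqP: ha; rewrite mulf_eq0 => /orP[/eqP a0|/eqP //].
move/eqP: hb; rewrite mulf_eq0 => /orP[/eqP b0|/eqP //].
by move: ab_neq0; rewrite a0 b0 eqxx.
Qed.

(** On the line of equation a x + b y = d the slope has the sign of - a b. *)
Lemma line_monotone (R : realType) (L : set (R * R)) (lineL : is_line L)
    (s : seq (nat * nat)) :
  {in s, forall u, L (toPlane R u)} -> monotone_points s.
Proof.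
have [a [b [d [ab_neq0 ->]]]] := lineL; rewrite /= => hs.
have key u v : u \in s -> v \in s -> exists x y : R,
    [/\ a * x + b * y = 0, (v.1%:Z - u.1%:Z)%:~R = x & (v.2%:Z - u.2%:Z)%:~R = y].
  move=> /hs hu /hs hv; exists (v.1%:R - u.1%:R), (v.2%:R - u.2%:R).
  by split; [lra|rewrite rmorphB /= -!pmulrn..].
have [ab_le0|ab_gt0] := leP (a * b) 0; [left|right] => u v us vs.
  have [x [y [h hx hy]]] := key u v us vs.
  rewrite -(ler0z R) rmorphM /= hx hy.
  have [a0|a_neq0] := eqVneq a 0.
    have b_neq0 : b != 0 by apply: contra_neq ab_neq0 => ->; rewrite a0.
    move/eqP: h; rewrite a0 mul0r add0r mulf_eq0 (negPf b_neq0) /= => /eqP ->.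
    by rewrite mulr0.
  have a2 : 0 < a ^+ 2 by rewrite exprn_even_gt0.
  rewrite -(pmulr_rge0 _ a2).
  have -> : a ^+ 2 * (x * y) = (a * x + b * y) * (a * y) - (a * b) * y ^+ 2 by ring.
  by rewrite h mul0r sub0r -mulNr mulr_ge0 ?sqr_ge0 // oppr_ge0.
have [x [y [h hx hy]]] := key u v us vs.
rewrite -(lerz0 R) rmorphM /= hx hy.
have a2 : 0 < a ^+ 2.
  by rewrite exprn_even_gt0 //=; apply: contraTneq ab_gt0 => ->; rewrite mul0r ltxx.
rewrite -(pmulr_rle0 _ a2).
have -> : a ^+ 2 * (x * y) = (a * x + b * y) * (a * y) - (a * b) * y ^+ 2 by ring.
by rewrite h mul0r sub0r oppr_le0 mulr_ge0 ?sqr_ge0 // ltW.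
Qed.
End Lines.

(** * The extensible set *)

Local Open Scope classical_set_scope.
Local Open Scope ring_scope.

Lemma limn_einf_gt0 (R : realType) (u : nat -> \bar R) (e : R) N : 0 < e ->
  (forall n, (N <= n)%N -> (e%:E <= u n)%E) -> (0 < limn_einf u)%E.
Proof.
move=> e_gt0 hu; rewrite limn_einf_lim (cvg_lim _ (@cvg_einfs_sup _ u)) //.
apply: (@lt_le_trans _ _ e%:E); first by rewrite lte_fin.
apply: (@le_trans _ _ (einfs u N)); last by apply: ereal_sup_ubound; exists N.
by apply: le_ereal_inf_tmp => _ [n /= le_Nn <-]; exact: hu.
Qed.

Lemma dyadic_square_trunc_log j z : dyadic_square j z ->
  trunc_log 2 z.1 = j /\ trunc_log 2 z.2 = j.
Proof. by case/andP => h1 h2; split; apply: trunc_log_eq. Qed.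

Theorem theorem1p5 (R : realType) (alpha c : R) (k : nat -> R)
    (alpha_gt0 : 0 < alpha) (alpha_le1 : alpha <= 1) (c_gt0 : 0 < c)
    (kE : forall n : nat, (0 < n)%N -> k n = c * n%:R `^ alpha) :
  exists S : set (nat * nat),
    [/\ S `<=` posQuadrant,
        (0 < limn_einf (fun n : nat =>
               ((npoints (S `&` grid n))%:R / (k n * n%:R))%:E))%E
      & forall n : nat, (0 < n)%N ->
          forall L : set (R * R), is_line L ->
            (npoints ((@toPlane R @^-1` L) `&` S `&` grid n))%:R <= k n].
Proof.
pose a : R := 2 `^ alpha.
have a_gt1 : 1 < a.
  have := @gt0_ltr_powR _ _ alpha_gt0 1 2; rewrite powR1; apply;
    rewrite ?nnegrE; lra.
have a_le2 : a <= 2 by apply: ler1_powR => //; lra.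
have a_gt0 : 0 < a by lra.
have a_itv : 0 < a <= 2 by rewrite a_gt0.
have aE j : a ^+ j = (2 ^ j)%:R `^ alpha.
  by rewrite natrX -!powR_mulrn ?ltW // -!powRrM mulrC.
(* The second term makes the geometric sum of the 10 delta a ^ i, for i <= J, at
   most c a ^ J; the first one makes m <= p in the blocks. *)
pose delta := Num.min 1 (c * (a - 1) / (10 * a)).
have d_gt0 : 0 < delta.
  by rewrite lt_min ltr01 /= divr_gt0 ?mulr_gt0 // subr_gt0.
have d_le1 : delta <= 1 by rewrite ge_min lexx.
have d_itv : 0 < delta <= 1 by rewrite d_gt0.
have d_le : 10 * delta * a <= c * (a - 1).
  have : delta <= c * (a - 1) / (10 * a) by rewrite ge_min lexx orbT.
  rewrite ler_pdivlMr ?mulr_gt0 //; lra.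
have [j0 hj0] := exp_gt_linear (delta^-1 + 2) a_gt1.
have block j : exists A : pred (nat * nat), [/\ {subset A <= dyadic_square j},
    (forall s, uniq s -> {subset s <= A} ->
       {in s & &, forall u v w, collinear u v w} -> monotone_points s ->
       (size s)%:R <= 10 * delta * a ^+ j) &
    (j0 <= j)%N -> exists s, [/\ uniq s, {subset s <= A} &
      delta / 4 * 2 ^+ j * a ^+ j <= (size s)%:R]].
  have [le_j|lt_j] := leqP j0 j.
    have [p [p_pr le_p hp]] := prime_for_block a_itv d_gt0 (hj0 _ le_j).
    have [A [hA1 hA2 hA3]] := dyadic_block a_itv d_itv p_pr le_p hp.
    by exists A.
  (* Small indices, for which no suitable prime may exist, get an empty block. *)
  exists pred0; split=> // s _ sA _ _.
  case: s sA => [|z s] sA; last by have := sA z (mem_head _ _).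
  by rewrite mulr_ge0 ?exprn_ge0 ?mulr_ge0 ?ltW.
have [A hA] := choice block; pose S := [set z | z \in A (trunc_log 2 z.1)].
have squareS z : S z -> dyadic_square (trunc_log 2 z.1) z.
  by have [sub _ _] := hA (trunc_log 2 z.1); exact: sub.
have le_k n : (0 < n)%N -> c * a ^+ trunc_log 2 n <= k n.
  move=> n_gt0; rewrite kE // ler_pM2l // aE.
  apply: ge0_ler_powR; rewrite ?nnegrE ?ler_nat //; [exact: ltW|exact: trunc_logP].
have k_le n : (0 < n)%N -> k n <= c * a ^+ (trunc_log 2 n).+1.
  move=> n_gt0; rewrite kE // ler_pM2l // aE.
  apply: ge0_ler_powR; rewrite ?nnegrE ?ler_nat //; first exact: ltW.
  by rewrite ltnW // trunc_log_ltn.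
exists S; split.
- move=> z /squareS/andP[/andP[h1 _] /andP[h2 _]].
  by split; [apply: leq_trans h1|apply: leq_trans h2]; rewrite expn_gt0.
- (* With J as below, k n * n is at most (4 c a ^ J) (4 * 2 ^ J), while S has at
     least (delta / 4) 2 ^ J a ^ J points. *)
  apply: (@limn_einf_gt0 _ _ (delta / (64 * c)) (2 ^ j0.+1)).
    by rewrite divr_gt0 ?mulr_gt0.
  move=> n le_n; have n_gt0 : (0 < n)%N by rewrite (leq_trans _ le_n) ?expn_gt0.
  have k_gt0 : 0 < k n by rewrite kE // mulr_gt0 ?powR_gt0 ?ltr0n.
  have lt_j : (j0 < trunc_log 2 n)%N by apply: trunc_log_max.
  (* The last dyadic square contained in [1, n]^2; the one after it may be cut. *)
  set J := (trunc_log 2 n).-1; have JE : trunc_log 2 n = J.+1.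
    by rewrite prednK // (leq_ltn_trans _ lt_j).
  have [sub _ /(_ _)[|s [us sA sz]]] := hA J; first by rewrite -ltnS -JE.
  have le_s : (size s <= npoints (S `&` grid n))%N.
    apply: uniq_leq_size => // z /sA zA.
    rewrite (in_fset_set (finite_gridI S n)) inE.
    have zsq := sub _ zA; have [logz _] := dyadic_square_trunc_log zsq.
    split; first by rewrite /S /= logz.
    have le_Jn : (2 ^ J.+1 <= n)%N by rewrite -JE trunc_logP.
    have J_gt0 : (0 < 2 ^ J)%N by rewrite expn_gt0.
    case/andP: zsq => /andP[h1 h2] /andP[h3 h4].
    split; apply/andP; split.
    + exact: leq_trans J_gt0 h1.
    + exact: leq_trans (ltnW h2) le_Jn.
    + exact: leq_trans J_gt0 h3.
    + exact: leq_trans (ltnW h4) le_Jn.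
  rewrite lee_fin ler_pdivlMr ?mulr_gt0 ?ltr0n //.
  apply: (@le_trans _ _ (size s)%:R); last by rewrite ler_nat.
  apply: le_trans sz.
  have hk : k n <= c * (4 * a ^+ J).
    apply: le_trans (k_le n n_gt0) _; rewrite JE ler_pM2l // !exprS mulrA.
    by rewrite ler_pM2r ?exprn_gt0 //; nra.
  have hn : n%:R <= 4 * 2 ^+ J :> R.
    have : (n < 2 ^ J.+2)%N by rewrite -JE trunc_log_ltn.
    rewrite !expnS mulnA => /ltnW; rewrite -(ler_nat R) natrM natrX; exact.
  apply: (@le_trans _ _ (delta / (64 * c) * (c * (4 * a ^+ J) * (4 * 2 ^+ J)))).
    rewrite ler_pM2l ?divr_gt0 ?mulr_gt0 //.
    by apply: ler_pM => //; rewrite ltW.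
  rewrite le_eqVlt; apply/orP; left; apply/eqP; field; by rewrite gt_eqF.
- move=> n n_gt0 L lineL; apply: le_trans (le_k n n_gt0).
  set J := trunc_log 2 n; set T := _ `&` grid n.
  have finT : finite_set T by exact: finite_gridI.
  pose s : seq (nat * nat) := fset_set T.
  have us : uniq s by exact: fset_uniq.
  have sT z : z \in s -> T z by rewrite /s /= in_fset_set // inE.
  have slog : {in s, forall z, (trunc_log 2 z.1 < J.+1)%N}.
    by move=> z /sT[_ [/andP[_ le_zn] _]]; rewrite ltnS leq_trunc_log.
  rewrite /npoints -[#|` _|]/(size s) (sum_count_key slog) natr_sum.
  apply: (@le_trans _ _ (\sum_(j < J.+1) 10 * delta * a ^+ j)).
    apply: ler_sum => j _; rewrite -size_filter.
    have [_ hline _] := hA j.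
    have sub z : z \in [seq x <- s | trunc_log 2 x.1 == j] ->
        L (toPlane R z) /\ z \in A j.
      by rewrite mem_filter => /andP[/eqP <- /sT[[]]].
    apply: hline; first by rewrite filter_uniq.
    + by move=> z /sub[].
    + move=> u v w /sub[? _] /sub[? _] /sub[? _]; exact: (line_collinear lineL).
    + by apply: (line_monotone lineL) => u /sub[].
  rewrite -mulr_sumr -(ler_pM2r (_ : 0 < a - 1)) ?subr_gt0 //.
  have -> : 10 * delta * (\sum_(i < J.+1) a ^+ i) * (a - 1) =
      10 * delta * (a ^+ J.+1 - 1) by rewrite subrX1; ring.
  have aJ : 0 < a ^+ J by rewrite exprn_gt0.
  have : 10 * delta * a * a ^+ J <= c * (a - 1) * a ^+ J by rewrite ler_pM2r.
  rewrite exprS; lra.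
Qed.
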